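(* Let $N$ be a (possibly unbounded) linear normal operator on a complex Hilbert space $\mathcal{H}$. Then there is a conjugation $C$ on $\mathcal{H}$ such that $T:=NC$ is an antilinear normal operator and $T^\dagger T=N^*N$.
   Context: Scalar products are linear in the first variable; products have natural domains and equalities include domains. A linear normal operator is a densely defined closed linear operator $N$ with $N^*N=NN^*$. An operator $T$ on a linear subspace $\mathcal{D}(T)$ is antilinear if $T(\alpha x+\beta y)=\overline{\alpha}\,Tx+\overline{\beta}\,Ty$ for $\alpha,\beta\in\mathbb{C}$. For a densely defined antilinear $T$ on $\mathcal{H}$, the adjoint $T^\dagger$ is the antilinear operator whose domain consists of all $y\in\mathcal{H}$ for which there is $u\in\mathcal{H}$ with $\langle Tx,y\rangle=\langle u,x\rangle$ for all $x\in\mathcal{D}(T)$; then $T^\dagger y:=u$. A densely defined antilinear operator $T$ is normal if $T^\dagger T=TT^\dagger$. A conjugation on $\mathcal{H}$ is an everywhere defined antilinear isometric operator $C$ with $C^2=I$. *)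

(* Defs.v *)
From HB Require Import structures.
From mathcomp Require Import all_boot all_order all_algebra.
From mathcomp Require Import sesquilinear complex.
From mathcomp Require Import all_classical all_reals all_analysis.

Set Implicit Arguments.
Unset Strict Implicit.
Unset Printing Implicit Defensive.

Import Order.TTheory GRing.Theory Num.Theory numFieldNormedType.Exports.

Local Open Scope classical_set_scope.
Local Open Scope ring_scope.
Local Open Scope complex_scope.

(* The form [dot] is linear in its first and conjugate-linear in its second
   variable.  A complex Hilbert space is a complete normed space over R[i] whose
   norm comes from such a positive definite form. *)
Definition inner_product (R : realType) (H : completeNormedModType R[i])
    (dot : {dot H for @Num.conj R[i]}) : Prop :=
  forall x : H, dot x x = `|x| ^+ 2.

(* A partially defined map: the values of [opfun] off [dom] are irrelevant, so
   operators are to be compared by [eqop] and not by Leibniz equality. *)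
Record operator (H : Type) : Type := Operator {
  dom : set H;
  opfun :> H -> H
}.

Definition eqop (H : Type) (S T : operator H) : Prop :=
  dom S = dom T /\ forall x, dom S x -> S x = T x.

Definition compop (H : Type) (S T : operator H) : operator H :=
  Operator [set x | dom T x /\ dom S (T x)] (S \o T).

Definition idop (H : Type) : operator H := Operator [set: H] idfun.

Section Operators.
Context (R : realType) (H : completeNormedModType R[i]).
Context (dot : {dot H for @Num.conj R[i]}).
Implicit Types T N C : operator H.

Definition linear_subspace (D : set H) : Prop :=
  D 0 /\ forall (a b : R[i]) x y, D x -> D y -> D (a *: x + b *: y).

Definition linear_op T : Prop :=
  linear_subspace (dom T) /\
  forall (a b : R[i]) x y, dom T x -> dom T y ->
    T (a *: x + b *: y) = a *: T x + b *: T y.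

Definition antilinear_op T : Prop :=
  linear_subspace (dom T) /\
  forall (a b : R[i]) x y, dom T x -> dom T y ->
    T (a *: x + b *: y) = Num.conj a *: T x + Num.conj b *: T y.

Definition densely_defined T : Prop := dense (dom T).

Definition graph T : set (H * H) := [set (x, T x) | x in dom T].

Definition closed_op T : Prop := closed (graph T).

(* In both adjoints [u] is unique as soon as [T] is densely defined, so that
   [xget] makes no choice on the domain. *)
Definition adjoint_rel T (y u : H) : Prop :=
  forall x, dom T x -> dot (T x) y = dot x u.

Definition adjoint T : operator H :=
  Operator [set y | exists u, adjoint_rel T y u]
           (fun y => xget 0 [set u | adjoint_rel T y u]).

Definition antiadjoint_rel T (y u : H) : Prop :=
  forall x, dom T x -> dot (T x) y = dot u x.

Definition antiadjoint T : operator H :=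
  Operator [set y | exists u, antiadjoint_rel T y u]
           (fun y => xget 0 [set u | antiadjoint_rel T y u]).

Definition linear_normal N : Prop :=
  [/\ linear_op N, densely_defined N, closed_op N &
      eqop (compop (adjoint N) N) (compop N (adjoint N))].

Definition antilinear_normal T : Prop :=
  [/\ antilinear_op T, densely_defined T &
      eqop (compop (antiadjoint T) T) (compop T (antiadjoint T))].

Definition conjugation C : Prop :=
  [/\ dom C = [set: H], antilinear_op C, (forall x, `|C x| = `|x|) &
      eqop (compop C C) (idop H)].

End Operators.

(* Main.v *)
(* The antilinear adjoint of N C is C N^*, so it suffices that C commutes with
   N^* N, or equivalently with the bounded symmetric operator B = (1 + N^* N)^-1, which is
   obtained by projecting (y, 0) on the graph of N.  No spectral theorem is
   needed for that: by Zorn's lemma there is a maximal B-invariant set S on which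
   the inner product is real.  S is a closed real subspace and H = S + iS, since
   a vector z orthogonal to S could be adjoined together with all the B^n z.
   Then C (x + iy) = x - iy. *)

Require Import Defs.
From HB Require Import structures.
From mathcomp Require Import all_boot all_order all_algebra.
From mathcomp Require Import sesquilinear complex.
From mathcomp Require Import all_classical all_reals all_analysis.
From mathcomp Require Import ring lra.

Import Order.TTheory GRing.Theory Num.Theory numFieldNormedType.Exports.

Local Open Scope classical_set_scope.
Local Open Scope ring_scope.
Local Open Scope complex_scope.

Set Implicit Arguments.
Unset Strict Implicit.

(** * Completeness of products *)

Lemma cauchy_image (U V : uniformType) (f : U -> V) (F : set_system U) :
  Filter F -> unif_continuous f -> cauchy F -> cauchy (f @ F).
Proof.
move=> FF fc FC A /fc /FC [[P Q] /= [FP FQ] PQ].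
exists (f @` P, f @` Q) => [|[_ _] /= [[x Px <-] [y Qy <-]]].
  by split => /=; [apply: filterS FP | apply: filterS FQ] => x ?; exists x.
exact: (PQ (x, y)).
Qed.

Lemma prod_complete (U V : completeType) (F : set_system (U * V)) :
  ProperFilter F -> cauchy F -> exists l : U * V, F --> l.
Proof.
move=> FF FC.
have c1 : cvg (fst @ F).
  apply: cauchy_cvg; apply: cauchy_image => // A entA.
  by apply: filterS (prod_entP entA (@entourageT V)) => -[[? ?] [? ?]] [].
have c2 : cvg (snd @ F).
  apply: cauchy_cvg; apply: cauchy_image => // A entA.
  by apply: filterS (prod_entP (@entourageT U) entA) => -[[? ?] [? ?]] [].
exists (lim (fst @ F), lim (snd @ F)) => A [[P Q] /= [/c1 FP /c2 FQ]].
move=> PQ; have FPQ : F ((fst @^-1` P) `&` (snd @^-1` Q)) by exact: filterI.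
by apply: filterS FPQ => -[x y] xy; exact: PQ.
Qed.

(** * Two inequalities over ordered fields *)

(** The discriminant criterion, behind both Cauchy-Schwarz and the orthogonality of the
    projection. *)
Lemma quadratic_nonneg_bound (R : realFieldType) (a b c : R) :
  0 <= a -> (forall t, 0 <= t ^+ 2 * a + 2 * t * b + c) -> b ^+ 2 <= a * c.
Proof.
move=> a0 H.
have [a00|an0] := eqVneq a 0.
  have [->|bn0] := eqVneq b 0; first by rewrite a00 mul0r expr0n.
  (* With [a = 0] the polynomial is affine and takes the value -1 at this point. *)
  have := H (- (c + 1) / (2 * b)); rewrite a00 mulr0 add0r mul0r.
  have -> : 2 * (- (c + 1) / (2 * b)) * b = - (c + 1) by field.
  lra.
have ap : 0 < a by rewrite lt_neqAle eq_sym an0.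
have := H (- b / a).
have -> : (- b / a) ^+ 2 * a + 2 * (- b / a) * b + c = (a * c - b ^+ 2) / a.
  by field.
by rewrite ler_pdivlMr // mul0r subr_ge0.
Qed.

Lemma le0_of_small (R : realFieldType) (x c : R) :
  0 <= c -> (forall e, 0 < e -> x <= e * c) -> x <= 0.
Proof.
move=> c0 H; rewrite leNgt; apply/negP => x0.
have c1 : 0 < c + 1 by lra.
(* For [e = x / (c + 1)] the hypothesis reads [x <= x - e]. *)
have := H _ (divr_gt0 x0 c1).
have -> : x / (c + 1) * c = x - x / (c + 1) by field; rewrite gt_eqF.
by have := divr_gt0 x0 c1; lra.
Qed.

(** * Projection on closed real subspaces *)

Section Projection.
(** The norm of [V] need not come from [b], so that [H * H] with its maximum norm is covered;
    [norm_of_b] and [b_of_norm] say that both give the same topology. *)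
Context (R : realType) (V : normedModType R[i]) (b : V -> V -> R).
Context (V_complete : forall F : set_system V,
  ProperFilter F -> cauchy F -> exists l : V, F --> l).
Context (bC : forall x y, b x y = b y x).
Context (bD : forall x y z, b (x + y) z = b x z + b y z).
Context (bZ : forall (r : R) x y, b (r%:C *: x) y = r * b x y).
Context (b_ge0 : forall x, 0 <= b x x).
Context (norm_of_b : forall (e : R) x, 0 < e -> b x x < e ^+ 2 -> `|x| < e%:C).
Context (b_of_norm : forall e : R, 0 < e ->
  exists2 d : R[i], 0 < d & forall x, `|x| < d -> b x x < e).

Lemma formN x y : b (- x) y = - b x y.
Proof. by have := bZ (-1) x y; rewrite rmorphN1 scaleN1r mulN1r. Qed.

Lemma formDr x y z : b x (y + z) = b x y + b x z.
Proof. by rewrite bC bD !(bC x). Qed.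

Lemma formZr r x y : b x (r%:C *: y) = r * b x y.
Proof. by rewrite bC bZ bC. Qed.

Lemma formNr x y : b x (- y) = - b x y.
Proof. by rewrite bC formN bC. Qed.

Lemma form_cauchy_schwarz x y : b x y ^+ 2 <= b y y * b x x.
Proof.
apply: quadratic_nonneg_bound => // t.
have := b_ge0 (x + t%:C *: y); rewrite !(bD, formDr, bZ, formZr) (bC y x).
by congr (0 <= _); ring.
Qed.

(** By Cauchy-Schwarz, [b l y = b (l - x) y] is small when [x] is a point of the kernel close to
    [l]. *)
Lemma form_kernel_closed y : closed [set x | b x y = 0].
Proof.
move=> l /= cl; apply/eqP; rewrite -sqrf_eq0 eq_le sqr_ge0 andbT.
apply: le0_of_small (b_ge0 y) _ => e e0.
have [d d0 Hd] := b_of_norm e0.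
have [x [/= xy lx]] := cl _ (nbhsx_ballx l d d0).
have -> : b l y = b (l - x) y by rewrite bD formN xy oppr0 addr0.
apply: le_trans (form_cauchy_schwarz _ _) _; rewrite mulrC ler_wpM2r //.
by apply/ltW/Hd; move: lx; rewrite -ball_normE.
Qed.

(** The sets [D e] of near minimizers of the squared distance [q] to [p] generate a Cauchy filter,
    whose limit [l] lies in [G]. Orthogonality is obtained from near minimizers close to [l], up to
    an error that tends to 0. *)
Lemma closed_real_subspace_projection (G : set V) (p : V) : closed G -> G 0 ->
  (forall (r s : R) x y, G x -> G y -> G (r%:C *: x + s%:C *: y)) ->
  exists2 l, G l & forall h, G h -> b h (p - l) = 0.
Proof.
move=> clG G0 GD.
pose q x := b (p - x) (p - x).
pose d := inf [set q g | g in G].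
have hasinf : has_inf [set q g | g in G].
  split; first by exists (q 0), 0.
  by exists 0 => _ [g _ <-]; exact: b_ge0.
have dle g : G g -> d <= q g.
  by move=> Gg; apply: (ge_inf hasinf.2); exists g.
pose D (e : R) := [set g | G g /\ q g < d + e].
pose F := filter_from [set e : R | 0 < e] D.
have FF : ProperFilter F.
  apply: filter_from_proper => [|e e0].
    apply: filter_from_filter; first by exists 1 => /=; rewrite ltr01.
    move=> e1 e2 /= e10 e20; exists (Num.min e1 e2).
      by rewrite /= lt_min e10.
    move=> g [Gg]; rewrite -ltrBlDl lt_min => /andP[h1 h2].
    by split; split => //; rewrite -ltrBlDl.
  by have [_ [g Gg <-] qg] := inf_adherent e0 hasinf; exists g.
have FC : cauchy F.
  apply: cauchy_exP => eps eps0.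
  have [r r0 epsE] : exists2 r : R, 0 < r & eps = r%:C.
    case: eps eps0 => u v; rewrite ltcE /= => /andP[/eqP -> u0].
    by exists u.
  (* By the parallelogram law, with the midpoint of [g] and [g0] in [G], the squared distance of [g]
     and [g0] is less than [2 * (d + e) + 2 * (d + e) - 4 * d = 4 * e]. *)
  pose e := r ^+ 2 / 4.
  have e0 : 0 < e by rewrite divr_gt0 ?exprn_gt0.
  have [_ [g0 Gg0 <-] qg0] := inf_adherent e0 hasinf.
  exists g0, e => // g [Gg qg].
  rewrite -ball_normE /= epsE; apply: norm_of_b => //.
  have := dle _ (GD 2^-1 2^-1 _ _ Gg Gg0).
  move: qg qg0; rewrite -/d /q /e.
  rewrite !(bD, formDr, bZ, formZr, formN, formNr) (bC g0 p) (bC g p) (bC g g0).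
  rewrite (_ : 2^-1 = 1/2 :> R); last by lra.
  lra.
have [l Fl] := V_complete FF FC.
have Gl : G l.
  apply: (clG l) => B lB.
  have FG : F G by exists 1; [exact: ltr01 | move=> g []].
  exact: filter_ex (filterI FG (Fl _ lB)).
exists l => // h Gh.
have bnd e : 0 < e -> b (p - l) h ^+ 2 <= 4 * e * b h h.
  move=> e0.
  have [del del0 Hdel] := b_of_norm e0.
  have Fe : F (D e) by exists e.
  have [g [[Gg qg] lg]] := filter_ex (filterI Fe (Fl _ (nbhsx_ballx l del del0))).
  have h1 : b (g - l) h ^+ 2 <= b h h * e.
    apply: le_trans (form_cauchy_schwarz _ _) _; apply: ler_wpM2l => //.
    by apply/ltW/Hdel; move: lg; rewrite -ball_normE /= distrC.
  have h2 : b (p - g) h ^+ 2 <= b h h * e.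
    (* Moving [g] to [g - t h] inside [G] lowers [q] by less than [e], since [q g < d + e]. *)
    apply: quadratic_nonneg_bound => // t.
    have := dle _ (GD 1 (- t) _ _ Gg Gh).
    move: qg; rewrite /q rmorph1 scale1r opprD addrA.
    rewrite !(bD, formDr, bZ, formZr, formN, formNr) (bC h p) (bC h g) (bC g p).
    move=> A B; lra.
  have -> : b (p - l) h = b (g - l) h + b (p - g) h.
    by rewrite -bD; congr b; rewrite [RHS]addrC addrA subrK.
  by move: h1 h2 (b_ge0 h); nra.
have : b (p - l) h ^+ 2 <= 0.
  apply: (@le0_of_small _ _ (4 * b h h)) => [|e /bnd]; last by lra.
  by rewrite mulr_ge0.
by rewrite bC => le0; apply/eqP; rewrite -sqrf_eq0 eq_le le0 sqr_ge0.
Qed.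

End Projection.

(** * The real inner products of [H] and of [H * H] *)

Lemma complex_eq0_Re (R : rcfType) (z : R[i]) :
  complex.Re z = 0 -> complex.Re ('i * z) = 0 -> z = 0.
Proof.
case: z => a b /= ->; rewrite mul0r mul1r sub0r => /eqP.
by rewrite oppr_eq0 => /eqP ->.
Qed.

Section Hilbert.
Context (R : realType) (H : completeNormedModType R[i]).
Context (dot : {dot H for @Num.conj R[i]}) (ip : inner_product dot).

Lemma dotC x y : dot x y = (dot y x)^*%C.
Proof. by rewrite hermC expr0 mul1r. Qed.

Lemma dotZl a x y : dot (a *: x) y = a * dot x y.
Proof. by rewrite linearZl_LR. Qed.

Lemma dotZr a x y : dot x (a *: y) = a^*%C * dot x y.
Proof. by rewrite linearZr_LR. Qed.

Lemma dotDl x y z : dot (x + y) z = dot x z + dot y z.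
Proof. by rewrite linearDl. Qed.

Lemma dotDr x y z : dot x (y + z) = dot x y + dot x z.
Proof. by rewrite linearDr. Qed.

Definition rdot (x y : H) : R := complex.Re (dot x y).

Lemma rdotC x y : rdot x y = rdot y x.
Proof. by rewrite /rdot dotC; case: (dot y x). Qed.

Lemma rdotD x y z : rdot (x + y) z = rdot x z + rdot y z.
Proof. by rewrite /rdot dotDl raddfD. Qed.

Lemma rdotZ (r : R) x y : rdot (r%:C *: x) y = r * rdot x y.
Proof. by rewrite /rdot dotZl; case: (dot x y) => a b /=; rewrite mul0r subr0. Qed.

Lemma sqr_norm_rdot x : `|x| ^+ 2 = (rdot x x)%:C.
Proof. by rewrite -ip /rdot RRe_real // ip ger0_real // exprn_ge0. Qed.

Lemma rdot_ge0 x : 0 <= rdot x x.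
Proof. by rewrite -ler0c -sqr_norm_rdot exprn_ge0. Qed.

Lemma rdot_eq0 x : rdot x x = 0 -> x = 0.
Proof.
move=> x0; apply/eqP; rewrite -normr_eq0 -sqrf_eq0 sqr_norm_rdot x0.
exact/eqP.
Qed.

Lemma norm_lt_rdot (e : R) x : 0 < e -> (`|x| < e%:C) = (rdot x x < e ^+ 2).
Proof.
move=> e0; rewrite -[RHS]ltcR -sqr_norm_rdot rmorphXn /=.
by rewrite ltr_pXn2r // nnegrE // ler0c ltW.
Qed.

Lemma rdot_of_norm (e : R) : 0 < e ->
  exists2 d : R[i], 0 < d & forall x, `|x| < d -> rdot x x < e.
Proof.
move=> e0; exists (Num.sqrt e)%:C; first by rewrite ltcR sqrtr_gt0.
by move=> x; rewrite norm_lt_rdot ?sqrtr_gt0 // sqr_sqrtr // ltW.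
Qed.

Definition pair_rdot (p q : H * H) : R := rdot p.1 q.1 + rdot p.2 q.2.

Lemma pair_norm_lt (p : H * H) (d : R[i]) :
  (`|p| < d) = (`|p.1| < d) && (`|p.2| < d).
Proof.
rewrite prod_normE comparable_gt_max //.
exact: real_comparable.
Qed.

(** If [u] is nonzero, the ball of radius [|u|] around [u] contains some [x] in [D]; but [x] is
    orthogonal to [u], so its squared distance to [u] is at least [|u|^2]. *)
Lemma dense_ortho_eq0 (D : set H) u :
  dense D -> (forall x, D x -> dot x u = 0) -> u = 0.
Proof.
move=> dD Du; apply: contrapT => u0.
have u1 : 0 < `|u| by rewrite normr_gt0; exact/eqP.
have [|x [ux Dx]] := dD (ball u `|u|) _ (ball_open _ _).
  by exists u; exact: ballxx.
move: ux; rewrite -ball_normE /= -ltr_sqr ?nnegrE // !sqr_norm_rdot ltcR.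
have xu : rdot x u = 0 by rewrite /rdot Du.
have := rdot_ge0 x.
rewrite !(rdotD, formDr rdotC rdotD, formN rdotZ, formNr rdotC rdotZ) (rdotC u x) xu.
lra.
Qed.

(** * The resolvent of a closed operator *)

Lemma subspaceB (T : operator H) x y : linear_op T -> dom T x -> dom T y ->
  dom T (x - y) /\ T (x - y) = T x - T y.
Proof.
move=> [[_ D0] TD] Tx Ty.
by have := (D0 1 (-1) x y Tx Ty, TD 1 (-1) x y Tx Ty);
  rewrite !scale1r !scaleN1r => -[].
Qed.

(* [B] is the weak form of (1 + T^* T)^-1. *)
Lemma resolvent_exists (T : operator H) :
  linear_op T -> closed_op T -> exists B : H -> H,
  forall y, dom T (B y) /\
    forall w, dom T w -> dot w (B y) + dot (T w) (T (B y)) = dot w y.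
Proof.
move=> [[D0 DD] TD] clT.
suff /choice[B HB] : forall y, exists x, dom T x /\
    forall w, dom T w -> dot w x + dot (T w) (T x) = dot w y by exists B.
move=> y.
have T0 : T 0 = 0.
  by have := TD 0 0 0 0 D0 D0; rewrite !scale0r !addr0.
have [|||||||||_ [x Dx <-] /= xP] := @closed_real_subspace_projection R (H * H)%type
    pair_rdot _ _ _ _ _ _ _ (graph T) (y, 0) clT.
- exact: prod_complete.
- by move=> p q; rewrite /pair_rdot !(rdotC p.1) !(rdotC p.2).
- by move=> p q r; rewrite /pair_rdot /= !rdotD; ring.
- by move=> r p q; rewrite /pair_rdot /= !rdotZ; ring.
- by move=> p; rewrite addr_ge0 ?rdot_ge0.
- move=> e p e0; rewrite pair_norm_lt !norm_lt_rdot // /pair_rdot => pe.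
  by have := rdot_ge0 p.1; have := rdot_ge0 p.2; move: pe; lra.
- move=> e e0; have [d d0 dP] := rdot_of_norm (divr_gt0 e0 (ltr0n _ 2)).
  exists d => // p; rewrite pair_norm_lt => /andP[/dP + /dP].
  by rewrite /pair_rdot; lra.
- by exists 0 => //; rewrite T0.
- move=> r s _ _ [u Du <-] [v Dv <-].
  by exists (r%:C *: u + s%:C *: v); [exact: DD | rewrite TD].
exists x; split=> // w Dw.
(* The projection yields orthogonality of real parts only; testing with ['i *: w] as well gives the
   imaginary part. *)
have Diw : dom T ('i *: w).
  by have := DD 'i 0 w w Dw Dw; rewrite scale0r addr0.
have Tiw : T ('i *: w) = 'i *: T w.
  by have := TD 'i 0 w w Dw Dw; rewrite !scale0r !addr0.
have := (xP _ (imageP _ Dw), xP _ (imageP _ Diw)).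
rewrite /pair_rdot /rdot /= Tiw !dotZl -!raddfD -mulrDr.
rewrite !dotDr !linearNr linear0r => -[h1 h2].
have z0 := complex_eq0_Re h1 h2.
by apply/esym/eqP; rewrite -subr_eq0 -[X in _ == X]z0; apply/eqP; ring.
Qed.

Lemma dotNl x y : dot (- x) y = - dot x y.
Proof. by rewrite linearNl. Qed.

Lemma dotNr x y : dot x (- y) = - dot x y.
Proof. by rewrite linearNr. Qed.

Lemma dot0l y : dot 0 y = 0.
Proof. by rewrite linear0l. Qed.

Lemma dot0r y : dot y 0 = 0.
Proof. by rewrite linear0r. Qed.

Lemma dot_ext x y : (forall z, dot x z = dot y z) -> x = y.
Proof.
move=> xy; apply/eqP; rewrite -subr_eq0; apply/eqP/rdot_eq0.
by rewrite /rdot dotDl dotNl xy subrr.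
Qed.

(** * Real forms and conjugations commuting with a symmetric map *)

Definition idot (x y : H) : R := complex.Im (dot x y).

Lemma idotC x y : idot x y = - idot y x.
Proof. by rewrite /idot dotC; case: (dot y x). Qed.

Lemma idot_rdot x y : idot x y = rdot x ('i *: y).
Proof.
by rewrite /idot /rdot dotZr; case: (dot x y) => a b /=; ring.
Qed.

Lemma idotP x y : idot x y = 0 <-> dot x y = (rdot x y)%:C.
Proof.
by rewrite /idot /rdot; case: (dot x y) => a b /=; split => [->|[]].
Qed.

Lemma idotD x y z : idot (x + y) z = idot x z + idot y z.
Proof. by rewrite /idot dotDl raddfD. Qed.

Lemma idotZ (r : R) x y : idot (r%:C *: x) y = r * idot x y.
Proof. by rewrite !idot_rdot rdotZ. Qed.

(** Zorn's lemma is applied to arbitrary sets rather than subspaces, so that unions of chains are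
    harmless; linearity and closedness are then consequences of maximality. *)
Lemma exists_real_form (B : H -> H) : (forall x y, dot (B x) y = dot x (B y)) ->
  exists S : set H, [/\ (forall x, S x -> S (B x)),
    (forall x y, S x -> S y -> idot x y = 0),
    (forall (r s : R) x y, S x -> S y -> S (r%:C *: x + s%:C *: y)) &
    forall h, exists xy : H * H, [/\ S xy.1, S xy.2 & h = xy.1 + 'i *: xy.2]].
Proof.
move=> Bsym.
have Bidot x y : idot (B x) y = idot x (B y) by rewrite /idot Bsym.
pose P (S : set H) :=
  (forall x, S x -> S (B x)) /\ (forall x y, S x -> S y -> idot x y = 0).
have [S [[SB Sreal] Smax]] : exists S, P S /\ forall X, S `<` X -> ~ P X.
  apply: Zorn_bigcup => F FP totF; split.
    by move=> x [X FX Xx]; exists X => //; apply: (FP X FX).1.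
  move=> x y [X FX Xx] [Y FY Yy].
  by have [XY|YX] := totF _ _ FX FY; [apply: (FP Y FY).2 | apply: (FP X FX).2];
    auto.
(* Such an [X] can be united with [S] without losing invariance or reality. *)
have Smax' X : (forall x, X x -> X (B x)) ->
    (forall x y, X x -> X y -> idot x y = 0) ->
    (forall x y, X x -> S y -> idot x y = 0) -> X `<=` S.
  move=> XB Xreal XS; apply: contrapT => nXS.
  apply: (Smax (S `|` X)).
    split; first by move=> x; left.
    by move=> SXS; apply: nXS => x Xx; apply: SXS; right.
  split=> [x [/SB|/XB]|x y [Sx|Xx] [Sy|Xy]]; [by left|by right| | | |].
  - exact: Sreal.
  - by rewrite idotC XS // oppr0.
  - exact: XS.
  - exact: Xreal.
(* By maximality [S] equals its double annihilator [S2] for [idot], hence it is a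
   closed real subspace. *)
pose A := [set x | forall y, S y -> idot x y = 0].
have SA : S `<=` A by move=> x Sx y Sy; exact: Sreal.
pose S2 := [set x | forall y, A y -> idot x y = 0].
have S2S : S2 `<=` S.
  have S2A : S2 `<=` A by move=> x S2x y /SA /S2x.
  apply: Smax' => [x S2x y Ay|x y S2x /S2A /S2x|x y S2x /SA /S2x] //.
  (* The annihilator [A] is [B]-invariant because [S] is and [B] is symmetric; the same argument
     then passes from [A] to [S2]. *)
  by rewrite Bidot; apply: S2x => z Sz; rewrite Bidot; apply: Ay; exact: SB.
have SS2 : S `<=` S2 by move=> x Sx y Ay; rewrite idotC Ay // oppr0.
have Slin (r s : R) x y : S x -> S y -> S (r%:C *: x + s%:C *: y).
  move=> /SS2 Sx /SS2 Sy; apply: S2S => z Az.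
  by rewrite idotD !idotZ Sx // Sy // !mulr0 addr0.
have S0 : S 0 by apply: S2S => y _; rewrite /idot dot0l.
have rdot_closed y : closed [set x | rdot x y = 0].
  apply: form_kernel_closed => //.
  - exact: rdotC.
  - exact: rdotD.
  - exact: rdotZ.
  - exact: rdot_ge0.
  - exact: rdot_of_norm.
have Sclosed : closed S.
  have -> : S = \bigcap_(y in A) [set x | rdot x ('i *: y) = 0].
    rewrite eqEsubset; split=> x.
      by move=> /SS2 Sx y /Sx /=; rewrite idot_rdot.
    by move=> Sx; apply: S2S => y /Sx /=; rewrite idot_rdot.
  by apply: closed_bigI => y _.
have proj p : exists2 l, S l & forall h, S h -> rdot h (p - l) = 0.
  apply: closed_real_subspace_projection => //.
  - by move=> F FF FC; exists (lim F); exact: cauchy_cvg.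
  - exact: rdotC.
  - exact: rdotD.
  - exact: rdotZ.
  - exact: rdot_ge0.
  - by move=> e x e0; rewrite norm_lt_rdot.
  - exact: rdot_of_norm.
exists S; split => // h.
(* If [h = x + 'i *: y], then [- 'i *: h = y - 'i *: x], and ['i *: x] is orthogonal to [S] for
   [rdot] since [S] is real; hence [y] must be the projection of [- 'i *: h]. *)
have [x Sx xP] := proj h.
have [y Sy yP] := proj (- ('i *: h)).
exists (x, y); split => //=.
apply/eqP; rewrite -subr_eq0 opprD addrA; apply/eqP.
set z := h - x - 'i *: y.
have zS w : S w -> dot w z = 0.
  move=> Sw.
  have Sw0 v : S v -> dot w v = (rdot w v)%:C.
    by move=> Sv; apply/idotP/Sreal.
  have := xP _ Sw; have := yP _ Sw.
  rewrite /rdot /z !(dotDr, dotNr) !dotZr (Sw0 x) // (Sw0 y) //.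
  case: (dot w h) => a b; simpc => /= h1 h2.
  by rewrite h2 (_ : b + _ = 0) //; lra.
have iterB n x' y' : dot (iter n B x') y' = dot x' (iter n B y').
  by elim: n x' => [|n IH] x' //; rewrite iterSr IH Bsym.
have SiterB n w : S w -> S (iter n B w).
  by move=> Sw; elim: n => //= n IH; exact: SB.
(* Once in [S], the vector [z] is orthogonal to itself. To get it there, the whole orbit of [z]
   under [B] is adjoined: its products with [S] vanish, and those within it depend only on [n + m],
   so they equal their conjugates. *)
suff Sz : S z by apply/rdot_eq0; rewrite /rdot zS.
apply: (Smax' [set iter n B z | n in [set: nat]]); last by exists 0%N.
- by move=> _ [n _ <-]; exists n.+1.
- move=> _ _ [n _ <-] [m _ <-].
  have e : dot (iter n B z) (iter m B z) = dot (iter m B z) (iter n B z).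
    by rewrite !iterB -!iterD addnC.
  by have := idotC (iter n B z) (iter m B z); rewrite /idot -e; lra.
- by move=> _ w [n _ <-] Sw; rewrite /idot iterB dotC zS ?conjc0 //; exact: SiterB.
Qed.

Lemma exists_commuting_conjugation (B : H -> H) :
  (forall x y, dot (B x) y = dot x (B y)) ->
  exists C : H -> H, [/\ involutive C, (forall x y, dot (C x) y = dot (C y) x),
    (forall (a b : R[i]) x y,
      C (a *: x + b *: y) = Num.conj a *: C x + Num.conj b *: C y) &
    forall x, C (B x) = B (C x)].
Proof.
move=> Bsym; have [S [SB Sreal Slin Sgen]] := exists_real_form Bsym.
have /choice[f fP] := Sgen.
pose C h := (f h).1 - 'i *: (f h).2.
have SBlin x y : S x -> S y -> S (x - y).
  by move=> Sx Sy; have := Slin 1 (-1) _ _ Sx Sy; rewrite rmorphN1 scale1r scaleN1r.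
have Sdot x y : S x -> S y -> dot x y = (rdot x y)%:C.
  by move=> Sx Sy; apply/idotP/Sreal.
have uniq0 u v : S u -> S v -> u + 'i *: v = 0 -> u = 0 /\ v = 0.
  move=> Su Sv uv.
  (* The real part of the product with [u] is [rdot u u]; the imaginary part of the product with [v]
     is [- rdot v v]. *)
  have := congr1 (dot u) uv; have := congr1 (dot v) uv.
  rewrite !dot0r !dotDr !dotZr !Sdot //; simpc => -[_ /eqP vv] [/eqP uu _].
  by split; apply/rdot_eq0/eqP; move: vv uu; rewrite ?oppr_eq0.
have CE x y : S x -> S y -> C (x + 'i *: y) = x - 'i *: y.
  move=> Sx Sy; have [Su Sv] := fP (x + 'i *: y).
  rewrite /C; move: (f _).1 (f _).2 Su Sv => u v Su Sv xyuv.
  have [|||xu yv] := uniq0 (x - u) (y - v); [exact: SBlin|exact: SBlin| |].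
    by rewrite scalerBr addrACA -opprD xyuv subrr.
  by rewrite (subr0_eq xu) (subr0_eq yv).
clearbody C.
have decomp h : exists x y, [/\ S x, S y, h = x + 'i *: y & C h = x - 'i *: y].
  have [xy [Sx Sy ->]] := Sgen h; exists xy.1, xy.2; split => //; exact: CE.
have SN y : S y -> S (- y).
  move=> Sy; have := Slin (-1) 0 _ _ Sy Sy.
  by rewrite rmorphN1 rmorph0 scaleN1r scale0r addr0.
have Csym u v : dot (C u) v = dot (C v) u.
  have [x [y [Sx Sy -> ->]]] := decomp u; have [z [t [Sz St -> ->]]] := decomp v.
  rewrite !(dotDl, dotDr, dotNl, dotNr) !dotZl !dotZr !Sdot //.
  have -> : ('i)^*%C = - 'i :> R[i] by simpc.
  by rewrite (rdotC z x) (rdotC z y) (rdotC t x) (rdotC t y); ring.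
have CK : involutive C.
  move=> h; have [x [y [Sx Sy -> ->]]] := decomp h.
  by rewrite -scalerN CE ?scalerN ?opprK //; exact: SN.
exists C; split => //.
(* Antilinearity follows from the symmetry of [C], which moves the combination to the
   conjugate-linear second variable. *)
- move=> a b x y; apply: dot_ext => z.
  rewrite Csym dotDr !dotZr dotDl !dotZl; congr (_ * _ + _ * _); exact: Csym.
- move=> h; have [x [y [Sx Sy -> ->]]] := decomp h.
  (* Linearity of [B] is read off from its symmetry. *)
  have Bi u v w : dot (B (u + 'i *: v)) w = dot (B u + 'i *: B v) w.
    by rewrite !(Bsym, dotDl, dotZl).
  rewrite (dot_ext (Bi _ _)) CE; [|exact: SB..].
  apply: dot_ext => w.
  by rewrite !(Bsym, dotDl, dotNl, dotZl).
Qed.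

(** * Values of the two adjoints *)

Lemma dense_dot_inj (D : set H) u v :
  dense D -> (forall x, D x -> dot x u = dot x v) -> u = v.
Proof.
move=> dD uv; apply/eqP; rewrite -subr_eq0; apply/eqP.
by apply: dense_ortho_eq0 dD _ => x Dx; rewrite dotDr dotNr uv // subrr.
Qed.

Lemma adjoint_relP (T : operator H) y :
  dom (adjoint dot T) y -> adjoint_rel dot T y (adjoint dot T y).
Proof. exact: (@xgetPex _ 0 [set u | adjoint_rel dot T y u]). Qed.

Lemma adjointE (T : operator H) y u :
  densely_defined T -> adjoint_rel dot T y u -> adjoint dot T y = u.
Proof.
move=> dT Tu; apply: (dense_dot_inj dT) => x Tx.
by rewrite -Tu // (@adjoint_relP T y _ x) //; exists u.
Qed.

Lemma antiadjoint_relP (T : operator H) y :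
  dom (antiadjoint dot T) y -> antiadjoint_rel dot T y (antiadjoint dot T y).
Proof.
exact: (@xgetPex _ 0 [set u | antiadjoint_rel dot T y u]).
Qed.

Lemma antiadjointE (T : operator H) y u :
  densely_defined T -> antiadjoint_rel dot T y u -> antiadjoint dot T y = u.
Proof.
move=> dT Tu; apply: (dense_dot_inj dT) => x Tx.
rewrite dotC [RHS]dotC -Tu // (@antiadjoint_relP T y _ x) //; by exists u.
Qed.

(** * A conjugation commuting with the operator [A = N^* N] *)

Section AdjointMul.
Context (N : operator H) (Nlin : linear_op N) (Ncl : closed_op N)
  (Ndense : densely_defined N).
Let A := compop (adjoint dot N) N.

(** The weak equation for [B y] says exactly that [y - B y] is the value of the adjoint of [N] at
    [N (B y)]. Symmetry holds since both sides equal the graph inner product of [B x] and [B y]. *)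
Lemma adjoint_mul_resolvent : exists B : H -> H,
  [/\ forall x y, dot (B x) y = dot x (B y),
      forall y, dom A (B y) /\ A (B y) = y - B y &
      forall x, dom A x -> B (x + A x) = x].
Proof.
have [B BP] := resolvent_exists Nlin Ncl.
have Arel y : adjoint_rel dot N (N (B y)) (y - B y).
  move=> w Nw; have [_ /(_ w Nw) wy] := BP y.
  by rewrite dotDr dotNr -wy addrAC subrr add0r.
have BA y : dom A (B y) /\ A (B y) = y - B y.
  split; last exact: adjointE.
  by split; [exact: (BP y).1 | exists (y - B y)].
exists B; split => // [x y|x [Nx Ax]].
  have [Nx ex] := BP x; have [Ny ey] := BP y.
  by rewrite -(ey _ Nx) (dotC x) -(ex _ Ny) rmorphD /= -!dotC.
have [Nz Hz] := BP (x + A x).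
have [Nd NdE] := subspaceB Nlin Nz Nx.
set z := B _ in Nz Hz Nd NdE *.
(* Both [z] and [x] solve the weak equation with right side [x + A x]; their difference solves the
   homogeneous one and is tested against itself. *)
suff /eqP : dot (z - x) (z - x) + dot (N (z - x)) (N (z - x)) = 0.
  rewrite !ip paddr_eq0 ?exprn_ge0 // sqrf_eq0 normr_eq0 subr_eq0.
  by move=> /andP[/eqP].
rewrite {2}NdE ?dotDr !dotNr addrACA Hz // dotDr -opprD.
by rewrite (adjoint_relP Ax) // subrr.
Qed.

(** Commutation passes from [B] to [A]: for [y = x + A x] one has [x = B y], so [C x = B (C y)] lies
    in the domain of [A], and [A (C x) = C y - C x = C (A x)]. *)
Lemma exists_conjugation_adjoint_mul : exists C : H -> H,
  [/\ involutive C, (forall x y, dot (C x) y = dot (C y) x),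
    (forall (a b : R[i]) x y,
      C (a *: x + b *: y) = Num.conj a *: C x + Num.conj b *: C y) &
    forall x, dom A x -> dom A (C x) /\ A (C x) = C (A x)].
Proof.
have [B [Bsym BA AB]] := adjoint_mul_resolvent.
have [C [CK Csym Clin CB]] := exists_commuting_conjugation Bsym.
exists C; split => // x /AB; set y := x + A x => xE.
have CD u v : C (u + v) = C u + C v.
  by have := Clin 1 1 u v; rewrite !rmorph1 !scale1r.
rewrite -{1 2}xE CB; have [? ->] := BA (C y); split => //.
by rewrite -CB xE /y CD addrAC subrr add0r.
Qed.

End AdjointMul.

Lemma conjugation_isometry (C : H -> H) : involutive C ->
  (forall x y, dot (C x) y = dot (C y) x) -> forall x, `|C x| = `|x|.
Proof.
move=> CK Csym x; apply/eqP; rewrite -(@eqrXn2 _ 2) //.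
by rewrite -!ip Csym CK.
Qed.

End Hilbert.

(** * Normality of [N C] *)

Unset Implicit Arguments.

Theorem proposition8 (R : realType) (H : completeNormedModType R[i])
    (dot : {dot H for @Num.conj R[i]}) (N : operator H) :
  inner_product dot ->
  linear_normal dot N ->
  exists C : operator H,
    conjugation C /\
    let T := compop N C in
    antilinear_normal dot T /\
    eqop (compop (antiadjoint dot T) T) (compop (adjoint dot N) N).
Proof.
move=> ip [Nlin Ndense Ncl [Ndom Neq]].
have [C [CK Csym Clin CA]] := exists_conjugation_adjoint_mul ip Nlin Ncl Ndense.
have Ciso := conjugation_isometry ip CK Csym.
have CD u v : C (u + v) = C u + C v.
  by have := Clin 1 1 u v; rewrite !rmorph1 !scale1r.
have CN u : C (- u) = - C u.
  by have := Clin (-1) 0 u 0; rewrite !rmorphN1 !rmorph0 !scaleN1r !scale0r !addr0.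
have C0 : C 0 = 0.
  by have := Clin 0 0 0 0; rewrite !rmorph0 !scale0r !addr0.
have [[N0 NS] NL] := Nlin.
set Cop := Operator [set: H] C.
exists Cop; split.
  by split => //=; split => [|x _]; [apply/seteqP; split | exact: CK].
set T := compop N Cop; cbv zeta.
have domT x : dom T x <-> dom N (C x) by split => [[]|].
have Tlin : antilinear_op T.
  split; last by move=> a b x y [_ Nx] [_ Ny]; rewrite /= Clin NL.
  split; first by apply/domT; rewrite C0.
  by move=> a b x y [_ Nx] [_ Ny]; apply/domT; rewrite Clin; exact: NS.
have Ccont : continuous C.
  move=> x; apply/cvgrPdist_lt => e e0.
  near=> y; rewrite -CN -CD Ciso; near: y.
  exact: (@cvgr_dist_lt _ _ _ _ _ id).
have Tdense : densely_defined T.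
  move=> O [x Ox] Oop.
  (* The domain of [T] is the image of the domain of [N] under the homeomorphism [C]. *)
  have [|y [Oy Ny]] := Ndense (C @^-1` O) _ (open_comp (in1W Ccont) Oop).
    by exists (C x); rewrite /= CK.
  by exists (C y); split=> //; apply/domT; rewrite CK.
(* Substituting [C x] for [x] turns one relation into the other, since [C] is a symmetric
   involution. *)
have TNadj y u : antiadjoint_rel dot T y u <-> adjoint_rel dot N y (C u).
  have symC x : dot u (C x) = dot x (C u).
    by rewrite (dotC dot) Csym -(dotC dot).
  split => TNy x Nx.
    have /TNy : dom T (C x) by apply/domT; rewrite CK.
    by rewrite /= CK symC.
  by rewrite /= (TNy _ (proj1 (domT x) Nx)) -symC CK.
have domTadj y : dom (antiadjoint dot T) y <-> dom (adjoint dot N) y.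
  by split => -[u]; [move/TNadj; exists (C u) | exists (C u); apply/TNadj; rewrite CK].
have Tadj y : dom (adjoint dot N) y -> antiadjoint dot T y = C (adjoint dot N y).
  move=> Ny; apply: antiadjointE => //; apply/TNadj; rewrite CK.
  exact: adjoint_relP.
(* Here [T^+ T = C N^* N C], where [T^+] is the antilinear adjoint, and [C] commutes with
   [N^* N]. *)
have TT : eqop (compop (antiadjoint dot T) T) (compop (adjoint dot N) N).
  split.
    apply/seteqP; split => x.
      move=> [/domT Nx /domTadj Ax].
      by rewrite -[x]CK; apply: (CA _ _).1.
    by move=> /CA[[Nx Ax] _]; split; [apply/domT | apply/domTadj].
  move=> x [/domT Nx /domTadj Ax].
  have [_ ] : dom (compop (adjoint dot N) N) (C (C x)) /\
      compop (adjoint dot N) N (C (C x)) = C (compop (adjoint dot N) N (C x)).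
    exact: CA.
  by rewrite CK => AE; exact: etrans (Tadj _ Ax) (esym AE).
split => //; split => //.
(* In [T T^+ = N C C N^*] the two conjugations cancel, and normality of [N] turns [N N^*] into
   [N^* N], which is [T^+ T]. *)
case: TT => TTdom TTeq; split.
  rewrite TTdom Ndom; apply/seteqP; split => x [Ax].
    move=> Nx; split; first exact/domTadj.
    by apply/domT; rewrite Tadj // CK.
  move/domTadj in Ax.
  by move=> /domT; rewrite Tadj // CK.
move=> x Dx; rewrite TTeq // Neq -?TTdom //.
have : dom (compop N (adjoint dot N)) x by rewrite -Ndom -TTdom.
move=> [Ax _]; transitivity (N (C (C (adjoint dot N x)))); first by rewrite CK.
by rewrite -[RHS]/(N (C (antiadjoint dot T x))) Tadj.
Unshelve. all: by end_near.
Qed.
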